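(* For all natural numbers $k$, there is a $3$-connected finite simple graph $G$ such that $(q-2)^k$ divides the chromatic polynomial $P_G(q)$.
   Context: For a finite simple graph $G$, the chromatic polynomial $P_G$ is the unique polynomial such that $P_G(q)$ equals the number of proper $q$-colourings of $G$ for every non-negative integer $q$. Divisibility is in the polynomial ring $\mathbb{Z}[q]$. A graph is $3$-connected if it has more than $3$ vertices and deleting any set of fewer than $3$ vertices leaves a connected graph. *)

(* Defs.v *)
From mathcomp Require Import all_boot all_order all_algebra.

Set Implicit Arguments.
Unset Strict Implicit.
Unset Printing Implicit Defensive.

Import Order.TTheory GRing.Theory Num.Theory.

Local Open Scope ring_scope.

Record sgraph := SGraph {
  vertex :> finType;
  adj : rel vertex;
  adj_sym : symmetric adj;
  adj_irrefl : irreflexive adj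
}.

(* The empty set counts as connected here; this is immaterial in [k_connected],
   where fewer than k of more than k vertices are deleted. *)
Definition connected_on (G : sgraph) (A : {set G}) : Prop :=
  forall x y : G, x \in A -> y \in A ->
    connect (fun u v => [&& u \in A, v \in A & adj u v]) x y.

Definition k_connected (k : nat) (G : sgraph) : Prop :=
  (k < #|G|)%N /\ forall S : {set G}, (#|S| < k)%N -> connected_on (~: S).

Definition proper_colourings (G : sgraph) (q : nat) : {set {ffun G -> 'I_q}} :=
  [set f : {ffun G -> 'I_q} | [forall x, forall y, adj x y ==> (f x != f y)]].

Definition is_chromatic_poly (G : sgraph) (P : {poly int}) : Prop :=
  forall q : nat, P.[q%:R] = #|proper_colourings G q|%:R.

Lemma is_chromatic_poly_unique (G : sgraph) (P Q : {poly int}) :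
  is_chromatic_poly G P -> is_chromatic_poly G Q -> P = Q.
Proof.
move=> hP hQ; apply/eqP; rewrite -subr_eq0; apply/eqP.
pose s : seq int := [seq i%:R | i <- iota 0 (size (P - Q))].
apply: (@roots_geq_poly_eq0 _ _ s).
- apply/allP => _ /mapP [i _ ->].
  by rewrite rootE hornerD hornerN hP hQ subrr.
- rewrite map_inj_uniq ?iota_uniq // => i j /eqP.
  by rewrite eqr_nat => /eqP.
- by rewrite size_map size_iota.
Qed.

(* Deletion-contraction, for multigraphs given by a list of vertex pairs. *)
Lemma count_colourings_poly (n : nat) (s : seq ('I_n * 'I_n)) :
  {P : {poly int} | forall q : nat,
     P.[q%:R] = #|[set f : {ffun 'I_n -> 'I_q} |
                    all (fun e => f e.1 != f e.2) s]|%:R}.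
Proof.
elim: n s => [|n IHn] s.
  exists (if s is [::] then 1 else 0) => q; case: s => [|[[]]] //=.
  rewrite hornerE (_ : [set _ | _] = [set: {ffun 'I_0 -> 'I_q}]); last first.
    by apply/setP => f; rewrite !inE.
  by rewrite cardsT card_ffun !card_ord expn0.
elim: s => [|[x y] s [P hP]].
  exists 'X^(n.+1) => q.
  rewrite hornerXn (_ : [set _ | _] = [set: {ffun 'I_n.+1 -> 'I_q}]); last first.
    by apply/setP => f; rewrite !inE.
  by rewrite cardsT card_ffun !card_ord natrX.
case hx: (unlift y x) => [x'|]; last first.
  exists 0 => q; rewrite horner0.
  have -> : x = y by move: hx; case: unliftP.
  rewrite (_ : [set _ | _] = set0) ?cards0 //.
  by apply/setP => f; rewrite !inE /= eqxx.
have xE : x = lift y x' by move: hx; case: unliftP => // j -> [->].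
pose h (z : 'I_n.+1) : 'I_n := odflt x' (unlift y z).
have [Q hQ] := IHn [seq (h e.1, h e.2) | e <- s].
exists (P - Q) => q; rewrite hornerD hornerN hP hQ.
pose A := [set f : {ffun 'I_n.+1 -> 'I_q} | all (fun e => f e.1 != f e.2) s].
pose B := [set f : {ffun 'I_n.+1 -> 'I_q} | f x != f y].
pose up (g : {ffun 'I_n -> 'I_q}) : {ffun 'I_n.+1 -> 'I_q} := [ffun z => g (h z)].
have hl j : h (lift y j) = j by rewrite /h liftK.
have hy : h y = x' by rewrite /h unlift_none.
have up_inj : injective up.
  move=> g1 g2 /ffunP E; apply/ffunP => j.
  by move: (E (lift y j)); rewrite !ffunE hl.
rewrite (_ : [set f | all _ (_ :: _)] = A :&: B); last first.
  by apply/setP => f; rewrite !inE /= andbC.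
rewrite -/A -(cardsID B A) natrD -[RHS]addr0 -addrA; congr (_ + _).
apply/eqP; rewrite subr_eq0; apply/eqP; congr (_%:R).
rewrite -(card_imset _ up_inj); apply: eq_card => f; rewrite !inE negbK.
apply/andP/imsetP => [[/eqP fxy fs]|[g]].
  have fE z : f (lift y (h z)) = f z.
    rewrite /h; case: (unliftP y z) => [j ->|->] //=.
    by rewrite -xE.
  exists [ffun j => f (lift y j)].
    rewrite inE all_map; apply: sub_all fs => e /=.
    by rewrite !ffunE !fE.
  by apply/ffunP => z; rewrite !ffunE fE.
rewrite inE all_map => gs ->; split; first by rewrite !ffunE xE hl hy.
by apply: sub_all gs => e /=; rewrite !ffunE.
Qed.

Lemma chromatic_poly_exists (G : sgraph) : {P : {poly int} | is_chromatic_poly G P}.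
Proof.
pose s := [seq e <- enum (('I_#|G| * 'I_#|G|)%type : finType)
              | adj (enum_val e.1 : G) (enum_val e.2)].
have [P hP] := count_colourings_poly s.
exists P => q; rewrite hP; congr (_%:R).
pose t (f : {ffun 'I_#|G| -> 'I_q}) : {ffun G -> 'I_q} :=
  [ffun x => f (enum_rank x)].
have t_inj : injective t.
  move=> f g /ffunP E; apply/ffunP => i.
  by move: (E (enum_val i)); rewrite !ffunE enum_valK.
rewrite -(card_imset _ t_inj); apply: eq_card => f; rewrite inE.
apply/imsetP/forallP => [[g + ->] x|fP].
  rewrite inE => /allP gs; apply/forallP => y; apply/implyP => xy.
  rewrite !ffunE; apply: (gs (enum_rank x, enum_rank y)).
  by rewrite mem_filter mem_enum /= !enum_rankK xy.
exists [ffun i => f (enum_val i)]; last first.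
  by apply/ffunP => x; rewrite !ffunE enum_rankK.
rewrite inE; apply/allP => -[i j]; rewrite mem_filter /= => /andP [ij _].
by rewrite !ffunE; apply: (implyP (forallP (fP _) _) ij).
Qed.

Definition chromatic_poly (G : sgraph) : {poly int} :=
  sval (chromatic_poly_exists G).

Lemma chromatic_polyP (G : sgraph) : is_chromatic_poly G (chromatic_poly G).
Proof. exact: svalP. Qed.

(* Divisibility in the ring Z[q] itself: the library's %| on {poly int} is
   pseudo-divisibility, which allows rescaling by integer constants. *)
Definition zpoly_dvd (D P : {poly int}) : Prop := exists Q : {poly int}, P = Q * D.

(* Main.v *)
Require Import Defs.
From mathcomp Require Import all_boot all_order all_algebra.
From mathcomp Require Import ring zify.

(** Take a triangle with vertices a, b, c and a disjoint copy of K_{2,3}, whose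
    sides are {u, v} and {x1, x2, x3}; join u to b, v to c, and every xi to a.
    Glue many such copies (petals) along one common triangle to form a flower.

    A proper colouring of the triangle extends to the different petals
    independently, and each petal admits the same number R(q) of extensions
    whatever that colouring is, so the chromatic polynomial of a flower with m
    petals is P_{K_3} R^m ([chromatic_poly_flower]).  Once u and v are coloured,
    each xi takes any colour outside {a, u, v} (vertices standing for their
    colours), so R(q) is the sum of (q - |{a, u, v}|)^3 over the colours u other
    than b and v other than c.  The set {a, u, v} has one element in exactly one
    case, two in 3q - 7 cases, and three in q^2 - 5q + 7 cases, whence
    R(q) = (q-1)^3 + (3q-7)(q-2)^3 + (q^2-5q+7)(q-3)^3.
    At q = 2 the first and last terms are 1 and -1, so q - 2 divides R and
    (q - 2)^m divides the chromatic polynomial.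

    A flower is 3-connected because every vertex of a petal has three paths to
    the triangle that share only their origin ([k_connected_of_fans]): deleting
    two vertices leaves one of these paths intact, and what remains of the
    triangle is a clique. *)
Set Implicit Arguments.
Unset Strict Implicit.
Unset Printing Implicit Defensive.

Import GRing.Theory Num.Theory.

Local Open Scope ring_scope.

(** * Connectivity from fans to a clique *)

Lemma size_le_card_of_disjoint_hits (T : finType) (S : {set T})
    (ps : seq (seq T)) :
  uniq (flatten ps) -> all (has (mem S)) ps -> (size ps <= #|S|)%N.
Proof.
move=> ups hits; have: (size ps <= count (mem S) (flatten ps))%N.
  elim: ps hits {ups} => //= p ps IH /andP[hp /IH {IH}].
  by rewrite count_cat; move: hp; rewrite has_count; lia.
move=> /leq_trans; apply; rewrite -size_filter cardE.
apply: uniq_leq_size; first exact: filter_uniq.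
by move=> x; rewrite mem_filter mem_enum => /andP[].
Qed.

Lemma connect_of_path_avoiding (G : sgraph) (S : {set G}) (x : G) (p : seq G) :
  path (@adj G) x p -> x \notin S -> ~~ has (mem S) p ->
  connect (fun u v => [&& u \in ~: S, v \in ~: S & adj u v]) x (last x p).
Proof.
move=> xp xS pS; apply/connectP; exists p => //.
elim: p x xp xS pS => //= y p IH x /andP[xy yp] xS.
by rewrite negb_or => /andP[yS pS]; rewrite !inE xS yS xy IH.
Qed.

(** Fewer than [k] deleted vertices cannot meet all the [k] disjoint paths of a
    fan, so every surviving vertex is still linked to a surviving vertex of the
    clique [T]; any two of those are equal or adjacent. *)
Lemma k_connected_of_fans (k : nat) (G : sgraph) (T : {set G}) :
  (k < #|G|)%N ->
  {in T &, forall x y, x != y -> adj x y} ->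
  (forall x, x \notin T -> exists ps : seq (seq G),
     [/\ size ps = k, uniq (flatten ps)
       & all (fun p => path (@adj G) x p && (last x p \in T)) ps]) ->
  k_connected k G.
Proof.
move=> kG Tclique fans; split=> // S Sk.
pose e u v := [&& u \in ~: S, v \in ~: S & adj u v].
have to_T x : x \in ~: S -> exists2 t, t \in T :\: S & connect e x t.
  rewrite inE => xS; have [xT|/fans[ps [szps ups allps]]] := boolP (x \in T).
    by exists x; rewrite ?connect0 // inE xS.
  have /allPn[p pps pS] : ~~ all (has (mem S)) ps.
    apply/negP => /(size_le_card_of_disjoint_hits ups).
    by rewrite szps leqNgt Sk.
  have /andP[xp lT] := allP allps p pps.
  exists (last x p); last exact: connect_of_path_avoiding.
  rewrite inE lT andbT.
  (* The path may be empty, in which case its end is the surviving vertex x. *)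
  have := mem_last x p; rewrite inE => /orP[/eqP-> //|lp].
  by apply: contra pS => lS; apply/hasP; exists (last x p).
have e_sym : symmetric e by move=> u v; rewrite /e adj_sym andbCA.
move=> x y /to_T[s sT xs] /to_T[t tT yt].
apply: (connect_trans xs); apply: (@connect_trans _ _ t); last first.
  by rewrite (sym_connect_sym e_sym).
have [->|st] := eqVneq s t; first exact: connect0.
move: sT tT; rewrite !inE => /andP[sS sT] /andP[tS tT].
by apply: connect1; rewrite /e !inE sS tS Tclique.
Qed.

(** * Counting functions on sums and products *)

Lemma card_ffun_sum (A B C : finType) (P : pred {ffun A -> C})
    (Q : {ffun A -> C} -> pred {ffun B -> C}) :
  #|[set f : {ffun A + B -> C} |
      P [ffun a => f (inl a)] && Q [ffun a => f (inl a)] [ffun b => f (inr b)]]|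
    = (\sum_(g | P g) #|[set h | Q g h]|)%N.
Proof.
pose join (gh : {ffun A -> C} * {ffun B -> C}) : {ffun A + B -> C} :=
  [ffun x => match x with inl a => gh.1 a | inr b => gh.2 b end].
pose split (f : {ffun A + B -> C}) : {ffun A -> C} * {ffun B -> C} :=
  ([ffun a => f (inl a)], [ffun b => f (inr b)]).
have splitK : cancel split join.
  by move=> f; apply/ffunP => -[a|b]; rewrite !ffunE.
have joinK : cancel join split.
  by move=> [g h]; congr pair; apply/ffunP => x; rewrite !ffunE.
under eq_bigr do rewrite -sum1_card.
rewrite pair_big_dep -sum1_card (reindex join) /=; last first.
  by exists split => ? _.
apply: eq_bigl => -[g h]; rewrite !inE.
by case: (joinK (g, h)) => -> ->.
Qed.

Lemma card_ffun_prod (I W C : finType) (E : {set {ffun W -> C}}) :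
  #|[set f : {ffun I * W -> C} | [forall i, [ffun w => f (i, w)] \in E]]|
    = (#|E| ^ #|I|)%N.
Proof.
rewrite -(card_ffun_on I (mem E)).
pose cur (f : {ffun I * W -> C}) : {ffun I -> {ffun W -> C}} :=
  [ffun i => [ffun w => f (i, w)]].
have cur_inj : injective cur.
  move=> f g /ffunP fg; apply/ffunP => -[i w].
  by have /ffunP/(_ w) := fg i; rewrite !ffunE.
rewrite -(card_imset _ cur_inj); apply: eq_card => g.
apply/imsetP/ffun_onP => [[f + ->] i|gE].
  by rewrite inE ffunE => /forallP.
have curE : g = cur [ffun iw => g iw.1 iw.2].
  by apply/ffunP => i; apply/ffunP => w; rewrite !ffunE.
exists [ffun iw => g iw.1 iw.2]; last exact: curE.
rewrite inE; apply/forallP => i; have := gE i.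
by rewrite {1}curE ffunE.
Qed.

(** * Gluing copies of a graph onto a common core *)

Definition attach_adj (K W : sgraph) (t : K -> W -> bool) (I : finType) :
    rel (K + I * W) :=
  fun x y => match x, y with
    | inl a, inl b => adj a b
    | inl a, inr w | inr w, inl a => t a w.2
    | inr w, inr z => (w.1 == z.1) && adj w.2 z.2
  end.

Lemma attach_adj_sym (K W : sgraph) (t : K -> W -> bool) (I : finType) :
  symmetric (attach_adj t (I := I)).
Proof.
by move=> [a|w] [b|z] //=; [apply: adj_sym | rewrite eq_sym adj_sym].
Qed.

Lemma attach_adj_irrefl (K W : sgraph) (t : K -> W -> bool) (I : finType) :
  irreflexive (attach_adj t (I := I)).
Proof. by move=> [a|w] /=; rewrite ?adj_irrefl ?andbF. Qed.

Definition attach (K W : sgraph) (t : K -> W -> bool) (I : finType) : sgraph :=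
  SGraph (@attach_adj_sym K W t I) (@attach_adj_irrefl K W t I).

Definition extensions (K W : sgraph) (t : K -> W -> bool) (q : nat)
    (c : {ffun K -> 'I_q}) : {set {ffun W -> 'I_q}} :=
  [set h in proper_colourings W q
    | [forall a, forall w, t a w ==> (c a != h w)]].

Lemma proper_colouringsP (G : sgraph) (q : nat) (f : {ffun G -> 'I_q}) :
  reflect (forall x y, adj x y -> f x != f y) (f \in proper_colourings G q).
Proof.
rewrite inE; apply: (iffP forallP) => [H x y|H x].
  by have /forallP/(_ y)/implyP := H x; apply.
by apply/forallP => y; apply/implyP/H.
Qed.

Lemma extensionsP (K W : sgraph) (t : K -> W -> bool) (q : nat)
    (c : {ffun K -> 'I_q}) (h : {ffun W -> 'I_q}) :
  reflect (h \in proper_colourings W q /\ forall a w, t a w -> c a != h w)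
          (h \in extensions t c).
Proof.
rewrite [h \in extensions _ _]in_set; apply: (iffP andP) => -[hW H]; split=> //.
  by move=> a w; apply/implyP; move/forallP/(_ a)/forallP: H.
by apply/forallP => a; apply/forallP => w; apply/implyP/H.
Qed.

(** Once the core is coloured, the copies are coloured independently of one
    another; requiring the number of extensions to be the same for all colourings
    of the core turns the sum over these colourings into a product. *)
Lemma card_proper_colourings_attach (K W : sgraph) (t : K -> W -> bool)
    (I : finType) (q N : nat) :
  (forall c, c \in proper_colourings K q -> #|extensions t c| = N) ->
  #|proper_colourings (attach t I) q| = (#|proper_colourings K q| * N ^ #|I|)%N.
Proof.
move=> cardE.
pose Q (c : {ffun K -> 'I_q}) : pred {ffun I * W -> 'I_q} :=
  [pred h : {ffun I * W -> 'I_q}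
    | [forall i, [ffun w => h (i, w)] \in extensions t c]].
transitivity (\sum_(c in proper_colourings K q) #|[set h | Q c h]|)%N.
  rewrite -card_ffun_sum; apply: eq_card => f; rewrite [RHS]inE.
  apply/proper_colouringsP/andP => [fP|[fK /forallP fW]].
    split.
      by apply/proper_colouringsP => a b ab; rewrite !ffunE; apply: fP.
    apply/forallP => i; apply/extensionsP; split.
      apply/proper_colouringsP => w z wz; rewrite !ffunE; apply: fP.
      by rewrite /= eqxx.
    by move=> a w aw; rewrite !ffunE; apply: fP.
  have fKW a i w : t a w -> f (inl a) != f (inr (i, w)).
    by move=> aw; have /extensionsP[_ /(_ a w aw)] := fW i; rewrite !ffunE.
  move=> [a|[i w]] [b|[j z]] //=.
  - by move=> ab; have /proper_colouringsP/(_ a b ab) := fK; rewrite !ffunE.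
  - exact: fKW.
  - by move=> bw; rewrite eq_sym; apply: fKW.
  - case/andP=> /eqP<- wz.
    have /extensionsP[/proper_colouringsP/(_ w z wz)] := fW i.
    by rewrite !ffunE.
rewrite -sum_nat_const; apply: eq_bigr => c /cardE <-.
exact: card_ffun_prod.
Qed.

(** * Flowers and their connectivity *)

Definition complete_graph (T : finType) : sgraph :=
  @SGraph T (fun x y => x != y)
    (fun x y => congr1 negb (eq_sym x y)) (fun x => negbF (eqxx x)).

Definition complete_bipartite (A B : finType) : sgraph :=
  @SGraph (A + B)%type (fun x y => is_inl x != is_inl y)
    (fun x y => congr1 negb (eq_sym (is_inl x) (is_inl y)))
    (fun x => negbF (eqxx (is_inl x))).

Notation triangle := (complete_graph (option bool)).
Notation petal := (complete_bipartite bool 'I_3).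

(** In the notation of the introduction, [None] is a, [Some true] and
    [Some false] are b and c, [inl true] and [inl false] are u and v, and the
    [inr j] are the xi. *)
Definition petal_root (a : triangle) (w : petal) : bool :=
  a == match w with inl s => Some s | inr _ => None end.

Definition flower (m : nat) : sgraph :=
  attach petal_root 'I_m.

Lemma flower_3connected (m : nat) : (0 < m)%N -> k_connected 3 (flower m).
Proof.
move=> m_gt0.
apply: (@k_connected_of_fans 3 (flower m) [set inl a | a in triangle]).
- rewrite card_sum card_prod !card_ord card_option card_sum card_bool card_ord.
  by lia.
- move=> _ _ /imsetP[a _ ->] /imsetP[b _ ->] ab.
  by apply: contra ab => /eqP->.
have inT (a : triangle) : (inl a : flower m) \in [set inl a | a in triangle].
  exact: imset_f.
move=> [a|[i w]]; first by rewrite inT.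
move=> _; pose v w' : flower m := inr (i, w').
pose r a : flower m := inl a.
have vE w1 w2 : (v w1 == v w2) = (w1 == w2)
  by rewrite [LHS]/eq_op /= [LHS]/eq_op /= eqxx.
case: w => [s|j].
(* From u: directly to b, through x1 to a, and through x3 and v to c; the same
   from v with the roles of b and c exchanged. *)
- exists [:: [:: r (Some s)]; [:: v (inr ord0); r None];
             [:: v (inr ord_max); v (inl (~~ s)); r (Some (~~ s))]].
  by case: s; split=> //=; rewrite ?inE ?vE ?inT ?eqxx.
(* From xi: directly to a, through u to b, and through v to c. *)
- exists [:: [:: r None]; [:: v (inl true); r (Some true)];
             [:: v (inl false); r (Some false)]].
  by split=> //=; rewrite ?inE ?vE ?inT ?eqxx.
Qed.

(** * The number of extensions to a petal *)

Lemma sum_indicator (T : finType) (P : pred T) (a : T) :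
  P a -> \sum_(x | P x) (x == a)%:R = 1 :> int.
Proof.
move=> Pa; rewrite (bigD1 a) //= eqxx big1 ?addr0 // => x /andP[_ /negPf->].
by [].
Qed.

Lemma sum_neq_const (T : finType) (b : T) (r : int) :
  \sum_(x | x != b) r = r * (#|T|%:R - 1).
Proof.
rewrite sumr_const (cardC1 b) -subn1 -[LHS]mulr_natr natrB //.
by apply/card_gt0P; exists b.
Qed.

(** The number of coincidences among [a], [u], [v] is 0, 1 or 3.  The coefficient
    of the last term corrects the value which the linear term gives at three
    coincidences; in this form the sum over [u] and [v] needs no case analysis. *)
Lemma card_avoiding_three (C : finType) (a u v : C) (n := #|C|%:R : int) :
  #|~: [set a; u; v]|%:R ^+ 3 =
    (n - 3) ^+ 3
    + ((n - 2) ^+ 3 - (n - 3) ^+ 3) * ((u == a)%:R + (v == a)%:R + (u == v)%:R)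
    + ((n - 1) ^+ 3 - 3 * (n - 2) ^+ 3 + 2 * (n - 3) ^+ 3)
        * ((u == a)%:R * (v == a)%:R) :> int.
Proof.
have cardE (S : {set C}) : #|~: S|%:R = n - #|S|%:R :> int.
  by rewrite /n -(cardsC S) natrD addrC addKr.
rewrite cardE [[set a; u; v]]setUC cardsU1 cards2 !inE.
rewrite [v == u]eq_sym [a == u]eq_sym.
have [->|ua] := eqVneq u a; first rewrite [a == v]eq_sym.
  by case: (v == a); rewrite /=; ring.
have [->|va] := eqVneq v a; first by rewrite (negPf ua) /=; ring.
by case: (u == v); rewrite /=; ring.
Qed.

(** This is (q-1)^3 + (3q-7)(q-2)^3 + (q^2-5q+7)(q-3)^3, expanded in powers of
    y = q - 2 to make the factor q - 2 visible. *)
Definition petal_poly : {poly int} :=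
  let y := 'X - 2%:P in y * (y ^+ 4 - y ^+ 3 + 7 *: y ^+ 2 - 4 *: y + 7%:P).

Lemma horner_petal_poly (q : int) :
  petal_poly.[q] =
    (q - 2)
    * ((q - 2) ^+ 4 - (q - 2) ^+ 3 + 7 * (q - 2) ^+ 2 - 4 * (q - 2) + 7).
Proof.
by rewrite /petal_poly /= !(hornerM, hornerD, hornerN, horner_exp, hornerZ,
  hornerX, hornerC).
Qed.

Lemma sum_coincidences (C : finType) (a b c : C) (x y z : int) :
  a != b -> a != c -> b != c ->
  \sum_(u | u != b) \sum_(v | v != c)
     (x + y * ((u == a)%:R + (v == a)%:R + (u == v)%:R)
        + z * ((u == a)%:R * (v == a)%:R))
    = x * (#|C|%:R - 1) ^+ 2 + y * (3 * #|C|%:R - 4) + z.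
Proof.
move=> ab ac bc; set n : int := #|C|%:R.
have sum_eq u : \sum_(v | v != c) (u == v)%:R = 1 - (u == c)%:R :> int.
  under eq_bigr do rewrite eq_sym.
  have [->|uc] := eqVneq u c.
    by rewrite subrr big1 // => v /negPf->.
  by rewrite (@sum_indicator _ (fun v => v != c)) ?subr0.
transitivity (\sum_(u | u != b)
    (x * (n - 1) + y * ((u == a)%:R * (n - 1) + 1 + (1 - (u == c)%:R))
       + z * (u == a)%:R)).
  apply: eq_bigr => u _.
  rewrite !big_split /= -!mulr_sumr !big_split /= !sum_neq_const sum_eq.
  by rewrite (@sum_indicator _ (fun v => v != c)) // mulr1.
rewrite !big_split /= -!mulr_sumr !big_split /= !sumrN -mulr_suml.
rewrite !sum_neq_const.
rewrite -/n !(@sum_indicator _ (fun u => u != b)) //; first ring.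
by rewrite eq_sym.
Qed.

Lemma sum_card_avoiding_three (C : finType) (a b c : C) :
  a != b -> a != c -> b != c ->
  \sum_(u | u != b) \sum_(v | v != c) #|~: [set a; u; v]|%:R ^+ 3
    = petal_poly.[#|C|%:R] :> int.
Proof.
move=> ab ac bc.
under eq_bigr do under eq_bigr do rewrite card_avoiding_three.
by rewrite sum_coincidences // horner_petal_poly; ring.
Qed.

Lemma sum_ffun_bool (C : finType) (V : nmodType) (P Q : pred C)
    (F : C -> C -> V) :
  \sum_(p : {ffun bool -> C} | P (p true) && Q (p false)) F (p true) (p false)
    = \sum_(u | P u) \sum_(v | Q v) F u v.
Proof.
rewrite pair_big.
rewrite (reindex (fun uv : C * C => [ffun s => if s then uv.1 else uv.2])).
  by apply: eq_big => [uv|uv _]; rewrite !ffunE.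
exists (fun p : {ffun bool -> C} => (p true, p false))
  => [[u v] _|p _]; first by rewrite !ffunE.
by apply/ffunP => -[]; rewrite ffunE.
Qed.

(** Properness forces u to avoid b, v to avoid c, and the three xi to avoid the
    colours of a, u and v; the xi are otherwise free, which accounts for the
    cube. *)
Lemma card_petal_extensions (q : nat) (c : {ffun triangle -> 'I_q}) :
  c \in proper_colourings triangle q ->
  #|extensions petal_root c|%:R = petal_poly.[q%:R] :> int.
Proof.
move=> /proper_colouringsP cP.
have cNS s : c None != c (Some s) by apply: cP.
have cbc : c (Some true) != c (Some false) by apply: cP.
rewrite -[q in RHS]card_ord.
rewrite -(sum_card_avoiding_three (cNS true) (cNS false) cbc).
rewrite -sum_ffun_bool.
pose avoid (p : {ffun bool -> 'I_q}) : {set 'I_q} :=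
  ~: [set c None; p true; p false].
pose P (p : {ffun bool -> 'I_q}) :=
  (p true != c (Some true)) && (p false != c (Some false)).
pose Q p : pred {ffun 'I_3 -> 'I_q} := 
  [pred h : {ffun 'I_3 -> 'I_q} | [forall j, h j \in avoid p]].
transitivity ((\sum_(p | P p) #|[set h | Q p h]|)%N%:R : int).
  congr (_%:R); rewrite -card_ffun_sum; apply: eq_card => h; rewrite [RHS]inE.
  apply/extensionsP/andP => [[/proper_colouringsP hP hc]|].
    split; first by rewrite /P !ffunE ![_ == c _]eq_sym !hc.
    apply/forallP => j.
    by rewrite !inE !ffunE !negb_or ![h (inr j) == _]eq_sym hc ?hP.
  rewrite /P !ffunE => -[/andP[ht hf] /forallP hQ].
  have hQ' j : [&& h (inr j) != c None, h (inr j) != h (inl true)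
                 & h (inr j) != h (inl false)].
    by have := hQ j; rewrite !inE !ffunE !negb_or andbA.
  split; last first.
    move=> _ [[]|j] /eqP->; rewrite eq_sym //.
    by case/and3P: (hQ' j).
  apply/proper_colouringsP => -[s|j] [s'|j'] //= _; last first.
    by case/and3P: (hQ' j) => _; case: s'.
  by rewrite eq_sym; case/and3P: (hQ' j') => _; case: s.
rewrite natr_sum; apply: eq_bigr => p _.
rewrite -natrX -[3%N in RHS]card_ord -(card_ffun_on 'I_3 (mem (avoid p))).
congr (_%:R); apply: eq_card => h; rewrite inE.
by apply/forallP/ffun_onP.
Qed.

(** * The chromatic polynomial of a flower *)

Lemma chromatic_poly_flower (m : nat) :
  chromatic_poly (flower m) = chromatic_poly triangle * petal_poly ^+ m.
Proof.
apply: (is_chromatic_poly_unique (chromatic_polyP _)) => q.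
rewrite hornerM horner_exp chromatic_polyP.
(* For q < 3 the triangle has no proper colouring and [petal_poly] may be negative
   at q, so it is compared with a number of extensions only when one exists. *)
have [none|[c0 c0P]] := set_0Vmem (proper_colourings triangle q).
  rewrite (@card_proper_colourings_attach _ _ _ _ _ 0%N); last first.
    by move=> c; rewrite none inE.
  by rewrite none cards0 mul0r.
rewrite (@card_proper_colourings_attach _ _ _ _ _ #|extensions petal_root c0|);
  last first.
  move=> c cP; apply/eqP; rewrite -(eqr_nat int) (card_petal_extensions cP).
  by rewrite -(card_petal_extensions c0P).
by rewrite natrM natrX (card_petal_extensions c0P) card_ord.
Qed.

Theorem proposition1p2 (k : nat) :
  exists G : sgraph,
    k_connected 3 G /\ zpoly_dvd (('X - 2%:P) ^+ k) (chromatic_poly G).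
Proof.
(* One petal more than the exponent: without petals, for k = 0, the flower is a
   mere triangle. *)
exists (flower k.+1); split; first exact: flower_3connected.
set y := 'X - 2%:P.
have [S petalE] : exists S, petal_poly = S * y.
  by rewrite /petal_poly /= mulrC; eexists.
exists (chromatic_poly triangle * S ^+ k.+1 * y).
by rewrite chromatic_poly_flower petalE exprMn [y ^+ k.+1]exprS !mulrA.
Qed.
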